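(* Let $m,n\ge 1$ and let $R=(r_1,\dots,r_m)$ and $S=(s_1,\dots,s_n)$ be vectors of real numbers with $\sum_i r_i=\sum_j s_j$. Then $\mathcal{T}^{+}(R,S)\neq\emptyset$ if and only if $\mathcal{T}^{\infty}(R,S)\neq\emptyset$ and $\mathcal{T}^{0}(R,S)\neq\emptyset$. Likewise, if $R$ and $S$ have nonnegative integer components, then $\mathcal{T}^{+}_{\mathbb{Z}}(R,S)\neq\emptyset$ if and only if $\mathcal{T}^{\infty}_{\mathbb{Z}}(R,S)\neq\emptyset$ and $\mathcal{T}^{0}_{\mathbb{Z}}(R,S)\neq\emptyset$.
   Context: $\mathcal{T}(R,S)$ is the set of $m\times n$ matrices with nonnegative real entries whose $i$th row sum is $r_i$ and whose $j$th column sum is $s_j$ for all $i,j$. On $m\times n$ matrices let $(r_\infty A)_{i,j}=a_{i,\,n+1-j}$ (reflection in a vertical line), $(r_0 A)_{i,j}=a_{m+1-i,\,j}$ (reflection in a horizontal line), $(\rho_\pi A)_{i,j}=a_{m+1-i,\,n+1-j}$ (rotation by $\pi$), $\rho_0$ the identity, and $D_+=\{\rho_0,\rho_\pi,r_0,r_\infty\}$. $\mathcal{T}^{\infty}(R,S)$, $\mathcal{T}^{0}(R,S)$ and $\mathcal{T}^{+}(R,S)$ are the sets of $A\in\mathcal{T}(R,S)$ fixed by $r_\infty$, by $r_0$, and by every element of $D_+$, respectively. A subscript $\mathbb{Z}$ denotes the subset of those matrices all of whose entries are integers. *)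

(* Defs.v *)
From HB Require Import structures.
From mathcomp Require Import all_boot all_order all_algebra.
From mathcomp Require Import classical_sets reals.

Set Implicit Arguments.
Unset Strict Implicit.
Unset Printing Implicit Defensive.

Import Order.TTheory GRing.Theory Num.Theory.
Local Open Scope classical_set_scope.
Local Open Scope ring_scope.

Section TransportationMatrices.
Variables (K : realType) (m n : nat).
Implicit Types (A : 'M[K]_(m, n)) (R : 'rV[K]_m) (S : 'rV[K]_n).

(* Indices start at 0, so that rev_ord i (with value m - i.+1) is the
   1-based index m + 1 - i. *)
Definition refl_inf A : 'M[K]_(m, n) := \matrix_(i, j) A i (rev_ord j).

Definition refl_0 A : 'M[K]_(m, n) := \matrix_(i, j) A (rev_ord i) j.

Definition rot_pi A : 'M[K]_(m, n) := \matrix_(i, j) A (rev_ord i) (rev_ord j).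

Definition rot_0 A : 'M[K]_(m, n) := A.

Definition D_plus : set ('M[K]_(m, n) -> 'M[K]_(m, n)) :=
  [set rot_0; rot_pi; refl_0; refl_inf].

Definition transp R S : set 'M[K]_(m, n) :=
  [set A | [/\ forall i j, 0 <= A i j,
               forall i, \sum_j A i j = R 0 i &
               forall j, \sum_i A i j = S 0 j]].

Definition transp_inf R S : set 'M[K]_(m, n) :=
  [set A | transp R S A /\ refl_inf A = A].

Definition transp_0 R S : set 'M[K]_(m, n) :=
  [set A | transp R S A /\ refl_0 A = A].

Definition transp_plus R S : set 'M[K]_(m, n) :=
  [set A | transp R S A /\ forall g, D_plus g -> g A = A].

Definition integral_part (X : set 'M[K]_(m, n)) : set 'M[K]_(m, n) :=
  [set A | X A /\ forall i j, A i j \is a Num.int].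

End TransportationMatrices.

(* Main.v *)
(** For real entries, averaging a matrix fixed by [r_inf] with its image under
    [r_0] suffices, since a matrix fixed by [r_0] has palindromic row sums.

    For integer entries, a doubly symmetric matrix is determined by one quadrant
    together with half of the middle row, half of the middle column and the
    central entry [e]; a missing middle line is treated as a middle line with
    sum zero.  A symmetric matrix in each direction gives, by counting odd line
    sums, [2k <= sm] and [2l <= rm], where [sm], [rm] are the sums of the middle
    lines and [k], [l] count the odd sums among the first half of the rows,
    resp. columns.  The choice [e = min (sm - 2k, rm - 2l)] has the right residue
    modulo 4 for both half middle lines to exist with the prescribed parities,
    and what remains is an ordinary integral transportation problem for the
    quadrant. *)

Require Import Defs.
From HB Require Import structures.
From mathcomp Require Import all_boot all_order all_algebra.
From mathcomp Require Import classical_sets reals.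
From mathcomp Require Import zify.

Set Implicit Arguments.
Unset Strict Implicit.
Unset Printing Implicit Defensive.

Import Order.TTheory GRing.Theory Num.Theory.
Local Open Scope classical_set_scope.

(** * Transportation problems over the natural numbers *)

Local Open Scope nat_scope.

(* [big_ord_recr] followed by simplification changes the summation type into a
   form that [lia] no longer identifies with the one in other sums. *)
Lemma sum_ord_recr p (f : nat -> nat) :
  \sum_(i < p.+1) f i = \sum_(i < p) f i + f p.
Proof. exact: big_ord_recr. Qed.

(** Greedy: the last part takes [minn Y (b p)], and the earlier bounds can absorb the rest. *)
Lemma bounded_composition p (b : nat -> nat) Y : Y <= \sum_(i < p) b i ->
  exists2 y : nat -> nat, forall i, y i <= b i & \sum_(i < p) y i = Y.
Proof.
elim: p Y => [|p IH] Y.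
  by rewrite big_ord0 leqn0 => /eqP->; exists (fun=> 0) => //; rewrite big_ord0.
rewrite sum_ord_recr => hY.
have [|y yb ysum] := IH (Y - minn Y (b p)); first lia.
exists (fun i => if i == p then minn Y (b p) else y i) => [i|].
  by case: eqP => [->|_]; rewrite ?geq_minr.
rewrite big_ord_recr /= eqxx (eq_bigr (fun i : 'I_p => y i)) ?ysum; first lia.
by move=> i _; rewrite ltn_eqF.
Qed.

(** Induction on the rows: the last row is filled within the column capacities [b], and the reduced
    capacities [b j - y j] again balance the remaining rows. *)
Lemma nat_transportation p q (a b : nat -> nat) :
  \sum_(i < p) a i = \sum_(j < q) b j ->
  exists X : nat -> nat -> nat,
    (forall i, i < p -> \sum_(j < q) X i j = a i) /\
    (forall j, j < q -> \sum_(i < p) X i j = b j).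
Proof.
elim: p b => [|p IH] b.
  rewrite big_ord0 => /esym/eqP; rewrite sum_nat_eq0 => /forallP b0.
  exists (fun _ _ => 0); split=> // j jq; rewrite big_ord0.
  by have /= /eqP-> := b0 (Ordinal jq).
rewrite sum_ord_recr => hab.
have [|y yb ysum] := @bounded_composition q b (a p); first lia.
have [|X [Xr Xc]] := IH (fun j => b j - y j).
  have : \sum_(j < q) (b j - y j) + \sum_(j < q) y j = \sum_(j < q) b j.
    by rewrite -big_split; apply: eq_bigr => j _ /=; rewrite subnK.
  lia.
exists (fun i j => if i == p then y j else X i j); split=> [i|j jq].
  by rewrite ltnS leq_eqVlt; case: eqP => [->|_] //=; exact: Xr.
rewrite big_ord_recr /= eqxx (eq_bigr (fun i : 'I_p => X i j)) ?Xc ?subnK //.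
by move=> i _; rewrite ltn_eqF.
Qed.

(** * Middle lines with prescribed parities *)

Lemma odd_sum_count p (r : nat -> nat) :
  \sum_(i < p) r i = (\sum_(i < p) (r i)./2).*2 + \sum_(i < p) odd (r i).
Proof.
rewrite -muln2 big_distrl -big_split; apply: eq_bigr => i _ /=.
by rewrite muln2 addnC odd_double_half.
Qed.

(** Each [c i] must have the parity of [r i], so it starts at [odd (r i)]. The excess of [C] over
    the odd count is even and is handed out in pairs, at most [(r i)./2] of them at [i]. *)
Lemma bounded_composition_parity p (r : nat -> nat) C :
    \sum_(i < p) odd (r i) <= C -> C <= \sum_(i < p) r i ->
    odd C = odd (\sum_(i < p) r i) ->
  exists c d : nat -> nat,
    (forall i, (d i).*2 + c i = r i) /\ \sum_(i < p) c i = C.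
Proof.
rewrite odd_sum_count => kC Cr parC.
set k := \sum_(i < p) odd (r i) in kC Cr parC *.
have [|y yb ysum] :=
  @bounded_composition p (fun i => (r i)./2) (C - k)./2; first lia.
exists (fun i => odd (r i) + (y i).*2), (fun i => (r i)./2 - y i); split.
  by move=> i; have := yb i; lia.
rewrite big_split /= -/k.
have -> : \sum_(i < p) (y i).*2 = (\sum_(i < p) y i).*2.
  by rewrite -muln2 big_distrl; apply: eq_bigr => i _ /=; rewrite muln2.
rewrite ysum; lia.
Qed.

Lemma quadrant_transportation p q (r s : nat -> nat) rm sm :
    (\sum_(i < p) r i).*2 + rm = (\sum_(j < q) s j).*2 + sm ->
    (\sum_(i < p) odd (r i)).*2 <= sm -> (\sum_(j < q) odd (s j)).*2 <= rm ->
  exists F : nat -> nat -> nat,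
    [/\ forall i, i < p -> (\sum_(j < q) F i j).*2 + F i q = r i,
        forall j, j < q -> (\sum_(i < p) F i j).*2 + F p j = s j,
        (\sum_(j < q) F p j).*2 + F p q = rm &
        (\sum_(i < p) F i q).*2 + F p q = sm].
Proof.
have := odd_sum_count p r; have := odd_sum_count q s.
set k := \sum_(i < p) odd (r i); set l := \sum_(j < q) odd (s j).
move=> sE rE tot ksm lrm.
(* By [tot] the two arguments agree modulo 4. On the side attaining the minimum, the half middle
   line sums to exactly its odd count; on the other side, [tot] bounds its sum by the available
   total. *)
pose e := minn (sm - k.*2) (rm - l.*2).
have [||| c [x [rcx csum]]] :=
  @bounded_composition_parity p r (sm - e)./2; rewrite -/k; try lia.
have [||| d [y [sdy dsum]]] :=
  @bounded_composition_parity q s (rm - e)./2; rewrite -/l; try lia.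
have half_sum n (f g h : nat -> nat) : (forall i, (h i).*2 + g i = f i) ->
    (\sum_(i < n) h i).*2 + \sum_(i < n) g i = \sum_(i < n) f i.
  move=> fE; rewrite -muln2 big_distrl -big_split; apply: eq_bigr => i _ /=.
  by rewrite muln2.
(* The margins [x] and [y] balance: the two sides of [tot] are four times their totals plus the same
   [sm + rm - e]. *)
have [|X [Xr Xc]] := @nat_transportation p q x y.
  have := half_sum p _ _ _ rcx; have := half_sum q _ _ _ sdy; lia.
exists (fun i j => if i == p then if j == q then e else d j
                   else if j == q then c i else X i j).
rewrite !eqxx; split=> [i ip|j jq||].
- rewrite ltn_eqF // (eq_bigr (fun j : 'I_q => X i j)) ?Xr //.
  by move=> j _; rewrite ltn_eqF.
- rewrite ltn_eqF // (eq_bigr (fun i : 'I_p => X i j)) ?Xc //.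
  by move=> i _; rewrite ltn_eqF.
- rewrite (eq_bigr (fun j : 'I_q => d j)) ?dsum; first lia.
  by move=> j _; rewrite ltn_eqF.
- rewrite (eq_bigr (fun i : 'I_p => c i)) ?csum; first lia.
  by move=> i _; rewrite ltn_eqF.
Qed.

(** * Palindromic sums and unfolding of a quadrant *)

Lemma sum_palindrome m (f : nat -> nat) :
    (forall i, i < m -> f (m - i.+1) = f i) ->
  \sum_(i < m) f i = (\sum_(i < m./2) f i).*2 + odd m * f m./2.
Proof.
move=> fsym; rewrite -!(big_mkord xpredT f).
rewrite (@big_cat_nat _ _ _ m./2) ?leq_half_double //=; try lia.
rewrite (@big_cat_nat _ _ _ (m - m./2) m./2) /=; try lia.
have -> : \sum_(m./2 <= i < m - m./2) f i = odd m * f m./2.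
  have [om|om] := boolP (odd m).
    have -> : m - m./2 = m./2.+1 by lia.
    by rewrite big_nat1 mul1n.
  by rewrite big_geq //; lia.
have -> : \sum_(m - m./2 <= i < m) f i = \sum_(0 <= i < m./2) f i.
  rewrite big_nat_rev -{1}(add0n (m - m./2)) big_addn.
  rewrite (_ : m - (m - m./2) = m./2); last lia.
  rewrite !big_nat; apply: eq_bigr => i /andP[_ im].
  rewrite -(fsym i); last lia.
  congr f; lia.
lia.
Qed.

(** In a palindromic row only the middle entry is unpaired, so an odd row sum forces that entry to
    be at least 1. Each odd row of the first half has a mirror image, hence the doubling; for even
    [n] no row sum is odd. *)
Lemma odd_lines_le m n (a : nat -> nat -> nat) (r : nat -> nat) :
    (forall i j, i < m -> j < n -> a i (n - j.+1) = a i j) ->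
    (forall i, i < m -> \sum_(j < n) a i j = r i) ->
    (forall i, i < m -> r (m - i.+1) = r i) ->
  (\sum_(i < m./2) odd (r i)).*2 <= odd n * \sum_(i < m) a i n./2.
Proof.
move=> asym arow rsym.
have := @sum_palindrome m (fun i => odd (r i)).
move=> /(_ (fun i im => congr1 (fun x => nat_of_bool (odd x)) (rsym i im))).
suff : \sum_(i < m) odd (r i) <= odd n * \sum_(i < m) a i n./2 by lia.
rewrite big_distrr; apply: leq_sum => i _ /=.
rewrite -(arow i) // sum_palindrome; last by move=> j; exact: asym.
by rewrite oddD odd_double; case: (odd n) => //; lia.
Qed.

Lemma palindromic_nat_transportation m n (r s : nat -> nat)
    (a b : nat -> nat -> nat) :
    (forall i, i < m -> \sum_(j < n) a i j = r i) ->
    (forall j, j < n -> \sum_(i < m) a i j = s j) ->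
    (forall i j, i < m -> j < n -> a i (n - j.+1) = a i j) ->
    (forall i, i < m -> \sum_(j < n) b i j = r i) ->
    (forall j, j < n -> \sum_(i < m) b i j = s j) ->
    (forall i j, i < m -> j < n -> b (m - i.+1) j = b i j) ->
  exists G : nat -> nat -> nat,
    [/\ forall i, i < m -> \sum_(j < n) G i j = r i,
        forall j, j < n -> \sum_(i < m) G i j = s j,
        forall i j, i < m -> j < n -> G (m - i.+1) j = G i j &
        forall i j, i < m -> j < n -> G i (n - j.+1) = G i j].
Proof.
move=> ar ac asym br bc bsym.
(* Each symmetry makes one margin palindromic: [b] gives [r], [a] gives [s]. *)
have rsym i : i < m -> r (m - i.+1) = r i.
  move=> im; rewrite -!br //; last lia.
  by apply: eq_bigr => j _; rewrite bsym.
have ssym j : j < n -> s (n - j.+1) = s j.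
  move=> jn; rewrite -!ac //; last lia.
  by apply: eq_bigr => i _; rewrite asym.
have rtot : \sum_(i < m) r i = \sum_(j < n) s j.
  rewrite (eq_bigr (fun i : 'I_m => \sum_(j < n) a i j)).
    by rewrite exchange_big; apply: eq_bigr => j _; rewrite ac.
  by move=> i _; rewrite ar.
have mid_s : odd n * \sum_(i < m) a i n./2 = odd n * s n./2.
  by case on: (odd n) => //; rewrite ac //; lia.
have mid_r : odd m * \sum_(j < n) b m./2 j = odd m * r m./2.
  by case om: (odd m) => //; rewrite br //; lia.
have [|||F [Fr Fc Frm Fsm]] := @quadrant_transportation m./2 n./2 r s
    (odd m * r m./2) (odd n * s n./2).
- by rewrite -!sum_palindrome.
- by rewrite -mid_s; exact: odd_lines_le.
(* The bound on the middle row comes from the transpose of [b]. *)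
- rewrite -mid_r; apply: (@odd_lines_le n m (fun j i => b i j)) => //.
  by move=> j i jn im; rewrite bsym.
(* [fold k] picks the smaller index of each mirror pair, so reading [F] through it yields a matrix
   symmetric in both directions. *)
pose fold k i := minn i (k - i.+1).
have fold_rev k i : i < k -> fold k (k - i.+1) = fold k i by rewrite /fold; lia.
have fold_lt k i : i < k./2 -> fold k i = i by rewrite /fold; lia.
have fold_mid k : odd k -> fold k k./2 = k./2 by rewrite /fold; lia.
have fold_sum k (f : nat -> nat) : \sum_(i < k) f (fold k i) =
    (\sum_(i < k./2) f i).*2 + odd k * f k./2.
  rewrite (@sum_palindrome k (fun i => f (fold k i))); last first.
    by move=> i ik; rewrite fold_rev.
  congr (_.*2 + _); last by case ok: (odd k) => //; rewrite fold_mid.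
  by apply: eq_bigr => i _; rewrite fold_lt.
have fold_cases k i : i < k -> fold k i < k./2 \/ odd k /\ fold k i = k./2.
  by rewrite /fold; lia.
have r_fold i : i < m -> r (fold m i) = r i.
  by move=> im; rewrite /fold /minn; case: ifP => // _; exact: rsym.
have s_fold j : j < n -> s (fold n j) = s j.
  by move=> jn; rewrite /fold /minn; case: ifP => // _; exact: ssym.
(* A missing middle line has sum zero, so [F] vanishes on it. *)
have mid_col i : i <= m./2 -> odd n * F i n./2 = F i n./2.
  move: Fsm; case: (odd _) => [_|/eqP]; first by rewrite mul1n.
  rewrite mul0n addn_eq0 double_eq0 sum_nat_eq0 => /andP[/forallP F0 /eqP Fe].
  rewrite leq_eqVlt => /predU1P[->|ip]; first by rewrite Fe.
  by have /= /eqP-> := F0 (Ordinal ip).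
have mid_row j : j <= n./2 -> odd m * F m./2 j = F m./2 j.
  move: Frm; case: (odd _) => [_|/eqP]; first by rewrite mul1n.
  rewrite mul0n addn_eq0 double_eq0 sum_nat_eq0 => /andP[/forallP F0 /eqP Fe].
  rewrite leq_eqVlt => /predU1P[->|jq]; first by rewrite Fe.
  by have /= /eqP-> := F0 (Ordinal jq).
exists (fun i j => F (fold m i) (fold n j)); split.
- move=> i im; rewrite (fold_sum n (F (fold m i))) -(r_fold i im).
  case: (fold_cases m i im) => [lt|[om ->]]; rewrite mid_col ?(ltnW lt) //.
    exact: Fr.
  by rewrite Frm om mul1n.
- move=> j jn; rewrite (fold_sum m (F^~ (fold n j))) -(s_fold j jn).
  case: (fold_cases n j jn) => [lt|[on ->]]; rewrite mid_row ?(ltnW lt) //.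
    exact: Fc.
  by rewrite Fsm on mul1n.
- by move=> i j im jn; rewrite fold_rev.
- by move=> i j im jn; rewrite fold_rev.
Qed.

(** * Real matrices and averaging *)

Local Open Scope ring_scope.

Section Symmetric.
Variables (K : realType) (m n : nat).
Implicit Types (A : 'M[K]_(m, n)) (R : 'rV[K]_m) (S : 'rV[K]_n).

Lemma refl_infE A : refl_inf A = A <-> forall i j, A i (rev_ord j) = A i j.
Proof.
split=> [h i j|h]; first by rewrite -[in RHS]h mxE.
by apply/matrixP => i j; rewrite mxE.
Qed.

Lemma refl_0E A : refl_0 A = A <-> forall i j, A (rev_ord i) j = A i j.
Proof.
split=> [h i j|h]; first by rewrite -[in RHS]h mxE.
by apply/matrixP => i j; rewrite mxE.
Qed.

(** The rotation by pi is the composite of the two reflections, so being fixed by both is enough. *)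
Lemma transp_plusE R S :
  transp_plus R S = transp_inf R S `&` transp_0 R S.
Proof.
apply/seteqP; split=> A.
  move=> [TA fixA].
  split; (split; first by []); first by apply: fixA; right.
  by apply: fixA; left; right.
move=> [[TA infA] [_ zeroA]]; split=> // g [[[->|->]|->]|->] //.
apply/matrixP => i j; rewrite mxE.
by move/refl_infE: infA => ->; move/refl_0E: zeroA => ->.
Qed.

Lemma transp_0_palindrome R S A : transp_0 R S A ->
  forall i, R 0 (rev_ord i) = R 0 i.
Proof.
move=> [[_ Ar _] /refl_0E symA] i.
by rewrite -!Ar; apply: eq_bigr => j _; rewrite symA.
Qed.

Lemma transp_plus_average R S A B : transp_inf R S A -> transp_0 R S B ->
  transp_plus R S (2^-1 *: (A + refl_0 A)).
Proof.
move=> [[A0 Ar Ac] /refl_infE symA] /transp_0_palindrome Rpal.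
have half (x : K) : 2^-1 * (x + x) = x.
  by rewrite -mulr2n -[x *+ 2]mulr_natl mulKf ?pnatr_eq0.
have T : transp R S (2^-1 *: (A + refl_0 A)).
  split=> [i j|i|j].
  - by rewrite !mxE mulr_ge0 ?invr_ge0 ?addr_ge0.
  - under eq_bigr do rewrite !mxE.
    by rewrite -mulr_sumr big_split /= !Ar Rpal half.
  - under eq_bigr do rewrite !mxE.
    rewrite -mulr_sumr big_split /=.
    (* Reversing the rows only permutes the entries of a column. *)
    rewrite [X in _ + X](reindex_inj rev_ord_inj).
    under [X in _ + X]eq_bigr do rewrite rev_ordK.
    by rewrite Ac half.
rewrite transp_plusE; split; split=> //.
  by apply/refl_infE => i j; rewrite !mxE !symA.
by apply/refl_0E => i j; rewrite !mxE rev_ordK addrC.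
Qed.

End Symmetric.

(** * Transfer of the integral case to natural numbers *)

Section Integral.
Variables (K : realType) (m n : nat).
Implicit Types (A : 'M[K]_(m.+1, n.+1)) (R : 'rV[K]_m.+1) (S : 'rV[K]_n.+1).

(** Truncation loses nothing on nonnegative integer entries. Since [inord] sends an out-of-range
    index to 0, the sum identities hold for all natural [i] and [j]. *)
Lemma transp_truncn R S A : integral_part (transp R S) A ->
  exists a : nat -> nat -> nat,
  [/\ forall i j, a i j = Num.truncn (A (inord i) (inord j)),
      forall i, (\sum_(j < n.+1) a i j)%N = Num.truncn (R 0 (inord i)) &
      forall j, (\sum_(i < m.+1) a i j)%N = Num.truncn (S 0 (inord j))].
Proof.
move=> [[A0 Ar Ac] Aint].
have AE i j : A i j = (Num.truncn (A i j))%:R by rewrite truncnK // natrEint Aint A0.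
exists (fun i j => Num.truncn (A (inord i) (inord j))); split=> // [i|j].
  rewrite -Ar -[LHS](@natrK K _) natr_sum; congr Num.truncn.
  by apply: eq_bigr => j _; rewrite inord_val -AE.
rewrite -Ac -[LHS](@natrK K _) natr_sum; congr Num.truncn.
by apply: eq_bigr => i _; rewrite inord_val -AE.
Qed.

Lemma inord_rev k i : (i < k.+1)%N -> inord (k.+1 - i.+1) = rev_ord (inord i) :> 'I_k.+1.
Proof. by move=> ik; apply: val_inj; rewrite /= !inordK //; lia. Qed.

Lemma integral_transp_plus R S A B :
    (forall i, R 0 i \is a Num.nat) -> (forall j, S 0 j \is a Num.nat) ->
    integral_part (transp_inf R S) A -> integral_part (transp_0 R S) B ->
  integral_part (transp_plus R S) !=set0.
Proof.
move=> Rnat Snat [[TA /refl_infE symA] Aint] [[TB /refl_0E symB] Bint].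
have [a [aE ar ac]] := transp_truncn (conj TA Aint).
have [b [bE br bc]] := transp_truncn (conj TB Bint).
have [||G [Gr Gc G0 Ginf]] := @palindromic_nat_transportation m.+1 n.+1
    (fun i => Num.truncn (R 0 (inord i))) (fun j => Num.truncn (S 0 (inord j)))
    a b (fun i _ => ar i) (fun j _ => ac j) _ (fun i _ => br i) (fun j _ => bc j).
- by move=> i j im jn; rewrite !aE inord_rev // symA.
- by move=> i j im jn; rewrite !bE inord_rev // symB.
exists (\matrix_(i, j) (G i j)%:R); split; last by move=> i j; rewrite mxE rpred_nat.
have T : transp R S (\matrix_(i, j) (G i j)%:R).
  split=> [i j|i|j]; first by rewrite mxE ler0n.
    under eq_bigr do rewrite mxE.
    by rewrite -natr_sum Gr // inord_val truncnK.
  under eq_bigr do rewrite mxE.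
  by rewrite -natr_sum Gc // inord_val truncnK.
rewrite transp_plusE; split; split=> //.
  by apply/refl_infE => i j; rewrite !mxE Ginf.
by apply/refl_0E => i j; rewrite !mxE G0.
Qed.

End Integral.

Theorem theorem11 (K : realType) (m n : nat) (hm : (1 <= m)%N) (hn : (1 <= n)%N)
    (R : 'rV[K]_m) (S : 'rV[K]_n)
    (hRS : \sum_(i < m) R 0 i = \sum_(j < n) S 0 j) :
  (transp_plus R S !=set0 <->
     transp_inf R S !=set0 /\ transp_0 R S !=set0) /\
  ((forall i, R 0 i \is a Num.nat) -> (forall j, S 0 j \is a Num.nat) ->
   (integral_part (transp_plus R S) !=set0 <->
      integral_part (transp_inf R S) !=set0 /\
      integral_part (transp_0 R S) !=set0)).
Proof.
split=> [|Rnat Snat]; split.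
- by move=> [A]; rewrite transp_plusE => -[Ainf A0]; split; exists A.
- move=> [[A TA] [B TB]]; exists (2^-1 *: (A + refl_0 A)).
  exact: transp_plus_average TA TB.
- move=> [A [+ Aint]]; rewrite transp_plusE => -[Ainf A0].
  by split; exists A.
- case: m n hm hn R S hRS Rnat Snat => [//|m'] [//|n'] _ _ R S _ Rnat Snat.
  by move=> [[A TA] [B TB]]; exact: integral_transp_plus TA TB.
Qed.
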